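(* If $X$ is a compact geodesic space, then the following are equivalent. 1) $X$ is its own universal cover. 2) $\pi_{cl}(X)=\pi_1(X)$. 3) $Cr(X)=\emptyset$.
   Context: A geodesic space is a metric space in which any two points are joined by a curve whose length equals the distance between them. A cover is a connected covering space in the traditional sense. A universal cover of $X$ is a cover $f:Y\to X$ such that for any cover $g:Z\to X$ there is a cover $h:Y\to Z$ with $g\circ h=f$ (not necessarily simply connected). Let $X$ be a geodesic space with base point $*$ (immaterial up to isomorphism). For $\varepsilon>0$, an $\varepsilon$-chain is a finite sequence $\{x_0,\dots,x_n\}$ in $X$ with $d(x_{i-1},x_i)<\varepsilon$ for all $i$. A basic move adds or removes one point, keeping the endpoints fixed and keeping the result an $\varepsilon$-chain; two $\varepsilon$-chains are $\varepsilon$-homotopic if connected by finitely many basic moves. $\pi_\varepsilon(X)$ is the group, under concatenation, of classes of $\varepsilon$-loops ($\varepsilon$-chains that start and end at $*$); an $\varepsilon$-loop is $\varepsilon$-null if its class is that of $\{*\}$. A strong $\varepsilon$-chain along a path $\gamma:[a,b]\to X$ is an $\varepsilon$-chain $\{\gamma(t_0),\dots,\gamma(t_n)\}$ for a partition $a=t_0<\dots<t_n=b$ with $\gamma([t_{i-1},t_i])\subset B_\varepsilon(\gamma(t_{i-1}))\cap B_\varepsilon(\gamma(t_i))$ for each $i$. The well-defined surjective homomorphism $h_\varepsilon:\pi_1(X)\to\pi_\varepsilon(X)$ sends $[\gamma]$ to the class of any strong $\varepsilon$-chain along $\gamma$. Put $K_\varepsilon=\ker h_\varepsilon$ and $\pi_{cl}(X)=\bigcap_{\varepsilon>0}K_\varepsilon$.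 For compact geodesic $X$, $Cr(X)$ is the set of $\varepsilon>0$ for which there is an $\varepsilon$-loop at $*$ that is not $\varepsilon$-null but is $\delta$-null for all $\delta>\varepsilon$. *)

(* Defs.v *)
From mathcomp Require Import all_boot all_order all_algebra.
From mathcomp Require Import all_classical all_reals all_analysis.
From Stdlib Require Import Relation_Operators.

Set Implicit Arguments.
Unset Strict Implicit.
Unset Printing Implicit Defensive.

Import Order.TTheory GRing.Theory Num.Theory.
Import numFieldNormedType.Exports.
Local Open Scope classical_set_scope.
Local Open Scope ring_scope.

Section Geodesic.
Context {R : realType} {X : metricType R}.

(* Curves on [a, b] are functions on all of R; only their restriction to
   [a, b] is constrained.  In [itv_partition a b ts] the point a is not listed
   in ts, so that the partition is a :: ts. *)
Definition curve_length (a b : R) (g : R -> X) : \bar R :=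
  ereal_sup [set (\sum_(i < size ts)
      mdist (g (nth b (a :: ts) i)) (g (nth b (a :: ts) i.+1)))%:E
    | ts in itv_partition a b].

Definition geodesic_space : Prop :=
  forall x y : X, exists (a b : R) (g : R -> X),
    [/\ a <= b, {within `[a, b], continuous g}, g a = x, g b = y
      & curve_length a b g = (mdist x y)%:E].

End Geodesic.
Arguments geodesic_space {R} X.

Section Covers.

Definition homeo_between {Y X : topologicalType} (f : Y -> X)
    (V : set Y) (U : set X) : Prop :=
  [/\ set_bij V U f, {within V, continuous f}
    & exists s : X -> Y, {within U, continuous s} /\ {in V, cancel f s}].

Definition evenly_covered {Y X : topologicalType} (f : Y -> X) (U : set X) :
    Prop :=
  exists sheets : set (set Y),
    [/\ f @^-1` U = \bigcup_(V in sheets) V,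
        trivIset sheets id
      & forall V, sheets V -> open V /\ homeo_between f V U].

(* Surjectivity rules out the empty space as a cover. *)
Definition covering_map {Y X : topologicalType} (f : Y -> X) : Prop :=
  [/\ continuous f, set_surj [set: Y] [set: X] f
    & forall x : X, exists U, [/\ open U, U x & evenly_covered f U]].

Definition cover {Y X : topologicalType} (f : Y -> X) : Prop :=
  covering_map f /\ connected [set: Y].

Definition universal_cover {Y X : topologicalType} (f : Y -> X) : Prop :=
  cover f /\
  forall (Z : topologicalType) (g : Z -> X), cover g ->
    exists h : Y -> Z, cover h /\ g \o h = f.

End Covers.

Section Chains.
Context {R : realType} {X : metricType R}.

Definition eps_chain (eps : R) (c : seq X) : Prop :=
  c <> [::] /\ sorted (fun x y => mdist x y < eps) c.

Definition endpoints (c : seq X) : option (X * X) :=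
  if c is x :: s then Some (x, last x s) else None.

Definition adds_point (c c' : seq X) : Prop :=
  exists s1 z s2, c = s1 ++ s2 /\ c' = s1 ++ z :: s2.

(* The endpoints are fixed as points of X, not as positions in the list: the
   move between {x} and {x, x} is allowed. *)
Definition basic_move (eps : R) (c c' : seq X) : Prop :=
  [/\ eps_chain eps c, eps_chain eps c', endpoints c = endpoints c'
    & adds_point c c' \/ adds_point c' c].

Definition eps_homotopic (eps : R) : seq X -> seq X -> Prop :=
  clos_refl_trans (seq X) (basic_move eps).

Definition strong_eps_chain (eps a b : R) (g : R -> X) (c : seq X) : Prop :=
  exists ts, [/\ itv_partition a b ts, c = map g (a :: ts), eps_chain eps c
    & forall i, (i < size ts)%N ->
        let t := nth b (a :: ts) i in let u := nth b (a :: ts) i.+1 in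
        g @` `[t, u] `<=` ball (g t) eps `&` ball (g u) eps].

Variable x0 : X.

Definition eps_loop (eps : R) (c : seq X) : Prop :=
  eps_chain eps c /\ endpoints c = Some (x0, x0).

Definition eps_class (eps : R) (c : seq X) : set (seq X) :=
  [set c' | eps_loop eps c' /\ eps_homotopic eps c c'].

(* the identity element of pi_eps(X) *)
Definition pi_eps1 (eps : R) : set (seq X) := eps_class eps [:: x0].

Definition eps_null (eps : R) (c : seq X) : Prop :=
  eps_class eps c = pi_eps1 eps.

Definition Cr : set R :=
  [set eps | 0 < eps /\ exists c, [/\ eps_loop eps c, ~ eps_null eps c
    & forall delta, eps < delta -> eps_null delta c]].

Definition loop (g : R -> X) : Prop :=
  [/\ {within `[0, 1], continuous g}, g 0 = x0 & g 1 = x0].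

Definition loop_homotopic (g g' : R -> X) : Prop :=
  exists H : R * R -> X,
    [/\ {within `[0, 1] `*` `[0, 1], continuous H},
        forall s : R, s \in `[0, 1] -> H (s, 0) = g s,
        forall s : R, s \in `[0, 1] -> H (s, 1) = g' s,
        forall t : R, t \in `[0, 1] -> H (0, t) = x0
      & forall t : R, t \in `[0, 1] -> H (1, t) = x0].

Definition loop_class (g : R -> X) : set (R -> X) :=
  [set g' | loop g' /\ loop_homotopic g g'].

Definition pi1 : set (set (R -> X)) := [set loop_class g | g in loop].

(* The class of a strong eps-chain along a representative of p; it depends on
   neither choice, so that [get] picks from a singleton for p in pi1. *)
Definition h_eps (eps : R) (p : set (R -> X)) : set (seq X) :=
  get [set e | exists g c,
    [/\ p g, strong_eps_chain eps 0 1 g c & e = eps_class eps c]].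

Definition K_eps (eps : R) : set (set (R -> X)) :=
  pi1 `&` [set p | h_eps eps p = pi_eps1 eps].

Definition pi_cl : set (set (R -> X)) := \bigcap_(eps in [set e | 0 < e]) K_eps eps.

End Chains.

(* Main.v *)
From HB Require Import structures.
Require Import Defs.
From mathcomp Require Import all_boot all_order all_algebra.
From mathcomp Require Import all_classical all_reals all_analysis.
From mathcomp Require Import lra.
From Stdlib Require Import Relation_Operators.
Import Order.TTheory GRing.Theory Num.Theory.
Import numFieldNormedType.Exports.
Local Open Scope classical_set_scope.
Local Open Scope ring_scope.
Local Open Scope quotient_scope.

Set Implicit Arguments.
Unset Strict Implicit.
Unset Printing Implicit Defensive.

(** All three conditions say that every eps-loop at the base point is eps-null,
    for every eps > 0 ([loops_null]).

    For [Cr]: if an eps-loop c is not eps-null, let s be the supremum of the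
    scales at which c is not null; it is finite, since c is null at any scale
    that exceeds the distances from the base point to the points of c.  The
    inequalities that define a homotopy are strict and finite in number, so a
    homotopy at scale s survives at some smaller scale; hence c is not s-null
    and s lies in [Cr] ([Cr_empty_null]).

    For [pi_cl]: strong chains along homotopic loops are homotopic
    ([homotopic_strong_chains]), so K_eps is everything exactly when the strong
    chains along all loops are null, and every eps-loop is a strong chain along
    a concatenation of geodesics ([chain_strong_path]).

    For covers: both directions rest on one structure, a [local_action] of the
    points of X on a set Z over X, which moves z to a prescribed nearby point,
    compatibly on triangles of small side.  Homotopic chains then act equally.

    - The classes of eps-chains that start at the base point form a cover of X
      ([chain_cover_cover]) on which X acts by appending points.  If X is its
      own universal cover, this cover has a surjective section, so its
      projection is injective, and an eps-loop has the class of the constant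
      chain ([universal_cover_null]).

    - Conversely X acts locally on the total space of any cover, by lifting
      along connected sets inside evenly covered balls; the scale is a Lebesgue
      number, and balls are connected because X is geodesic.  The total space
      being connected, any two of its points are joined by the action of a
      chain; if loops are null, two points of one fibre coincide.  So a cover
      is a homeomorphism ([null_universal_cover]).

    The homotopy invariance of strong chains also comes from a local action:
    a map of the square lifts along the segments issued from a corner. *)

Local Notation eps_step eps := (fun x y => mdist x y < eps).

(** * Homotopies of chains *)
Section ChainHomotopy.
Context {R : realType} {X : metricType R}.
Implicit Types (eps : R) (x y z : X) (c : seq X).

Lemma basic_move_sym eps c c' : basic_move eps c c' -> basic_move eps c' c.
Proof. by case=> ? ? e h; split=> //; case: h; [right|left]. Qed.

Lemma eps_homotopic_sym eps c c' :
  eps_homotopic eps c c' -> eps_homotopic eps c' c.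
Proof.
elim=> [a b /basic_move_sym m|a|a b d _ ? _ ?]; [exact: rt_step|exact: rt_refl|].
by apply: rt_trans; eassumption.
Qed.

Lemma eps_homotopic_endpoints eps c c' :
  eps_homotopic eps c c' -> endpoints c = endpoints c'.
Proof. by elim=> [a b []|a|a b d _ -> _ ->]. Qed.

Lemma eps_homotopic_weaken eps eps' c c' : eps <= eps' ->
  eps_homotopic eps c c' -> eps_homotopic eps' c c'.
Proof.
move=> le; elim=> [a b|a|a b d _ ? _ ?]; last 2 first.
- exact: rt_refl.
- by apply: rt_trans; eassumption.
case=> -[a0 sa] [b0 sb] e h; apply: rt_step; split=> //; split=> //.
- by apply: sub_sorted sa => u v /lt_le_trans; apply.
- by apply: sub_sorted sb => u v /lt_le_trans; apply.
Qed.

Lemma last_endpoints x0 c c' : endpoints c = endpoints c' ->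
  last x0 c = last x0 c'.
Proof. by case: c c' => [|x c] [|x' c'] //= [_ ->]. Qed.

Lemma sorted_rcons (T : Type) (e : rel T) (d : T) (s : seq T) (y : T) :
  s <> [::] -> sorted e (rcons s y) = sorted e s && e (last d s) y.
Proof. by case: s => //= x s _; rewrite rcons_path. Qed.

Lemma eps_homotopic_rcons eps c c' y : mdist (last y c) y < eps ->
  eps_homotopic eps c c' -> eps_homotopic eps (rcons c y) (rcons c' y).
Proof.
move=> cy h; elim: h cy => [a b m cy|a _|a b d ab iab bd ibd cy]; last 2 first.
- exact: rt_refl.
- apply: rt_trans (iab cy) (ibd _).
  by rewrite -(last_endpoints _ (eps_homotopic_endpoints ab)).
have [[a0 sa] [b0 sb] e h] := m; apply: rt_step; split.
- by split; [case: (a)|rewrite (sorted_rcons _ y)// sa].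
- split; [by case: (b)|rewrite (sorted_rcons _ y)// sb/=].
  by rewrite -(last_endpoints _ e).
- by case: a b e {m a0 sa b0 sb h cy} => [|x s] [|x' s'] //= [-> _]; rewrite !last_rcons.
- case: h => -[s1 [z [s2 [-> ->]]]]; [left|right];
    by exists s1, z, (rcons s2 y); rewrite -!cats1 -!catA.
Qed.

(** The condition to which the three statements reduce: for every eps, the group
    of classes of eps-loops is trivial. *)
Definition loops_null (x0 : X) : Prop := forall eps c, 0 < eps ->
  eps_loop x0 eps c -> eps_homotopic eps c [:: x0].

End ChainHomotopy.

(** * Local actions of points *)
Section LocalAction.
Context {R : realType} {X : metricType R}.

(** The discrete form of unique path lifting: [p] is the projection of a space
    over X, and [act z y] is the endpoint of the lift from z of a short path
    from [p z] to y.  The triangle law says that small triangles lift to closed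
    triangles. *)
Record local_action (eps : R) (Z : Type) (p : Z -> X) (act : Z -> X -> Z) :
    Prop := LocalAction {
  act_tip : forall z y, mdist (p z) y < eps -> p (act z y) = y ;
  act_id : forall z, act z (p z) = z ;
  act_tri : forall z x y, mdist (p z) x < eps -> mdist x y < eps ->
    mdist (p z) y < eps -> act (act z x) y = act z y }.

Variables (eps : R) (Z : Type) (p : Z -> X) (act : Z -> X -> Z).
Hypothesis A : local_action eps p act.

Lemma act_foldl_tip z s : path (eps_step eps) (p z) s ->
  p (foldl act z s) = last (p z) s.
Proof.
elim: s z => //= y s ih z /andP[zy ys].
by rewrite ih (act_tip A).
Qed.

(** Inserting a point in the middle of a chain is the triangle law.  A point
    inserted at an end duplicates the endpoint, where [act_id] applies. *)
Lemma act_foldl_move z c c' : endpoints c = endpoints c' ->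
  ohead c = Some (p z) -> eps_chain eps c' -> eps_chain eps c ->
  adds_point c c' -> foldl act z c = foldl act z c'.
Proof.
move=> e hz [c'0 s'] [c0 s] [s1 [a [s2 [ce c'e]]]]; subst c c'.
case: s1 => [|x s1] in e hz s s' c0 c'0 *.
  case: s2 => [//|b s2] /= in e hz s s' c0 c'0 *.
  by move: hz e => [->] [<-]; rewrite !(act_id A).
move: hz s s' e => /= [->]; rewrite (act_id A) !foldl_cat !cat_path /=.
move=> /andP[p1 p2] /and3P[_ pa p3] e.
have := act_foldl_tip p1; set w := foldl act z s1 => pw.
case: s2 p2 p3 e {c0 c'0} => [|b s2] /=.
  move=> _ _ []; rewrite cats0 last_cat /= => <-.
  by rewrite -pw (act_id A).
move=> /andP[wb _] /andP[ab _] _; rewrite (act_tri A) ?pw//.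
Qed.

Lemma act_foldl_homotopic z c c' : eps_homotopic eps c c' ->
  ohead c = Some (p z) -> foldl act z c = foldl act z c'.
Proof.
elim=> [a b [ca cb e h] az|//|a b d ab iab bd ibd az]; last first.
  rewrite (iab az) ibd// -az; move/eps_homotopic_endpoints: ab.
  by case: (a) (b) => [|? ?] [|? ?] //= [->].
have hb : ohead b = Some (p z).
  by rewrite -az; case: a b e {ca cb h az} => [|? ?] [|? ?] //= [->].
by case: h => h; [|apply/esym]; apply: act_foldl_move.
Qed.

(** Each step can be undone by acting with the previous point of the chain. *)
Lemma act_foldl_inj z z' s : p z = p z' ->
  path (eps_step eps) (p z) s ->
  foldl act z s = foldl act z' s -> z = z'.
Proof.
elim: s z z' => //= y s ih z z' zz' /andP[zy ys] h.
have tz : p (act z y) = y by rewrite (act_tip A).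
have tz' : p (act z' y) = y by rewrite (act_tip A) -?zz'.
have e : act z y = act z' y by apply: ih h; rewrite ?tz ?tz'.
have eps0 : 0 < eps by rewrite (le_lt_trans _ zy)// mdist_ge0.
have back u : p u = p z -> act (act u y) (p z) = u.
  by move=> uz; rewrite (act_tri A) ?uz ?mdistxx// -?uz ?(act_id A)// metric_sym uz.
by rewrite -[LHS]back// e back.
Qed.

End LocalAction.

(** * Classes of chains from the base point *)
Section ChainCover.
Context {R : realType} {X : metricType R}.
Variables (x0 : X) (eps : R).

Definition based_chain (c : seq X) : bool :=
  (ohead c == Some x0) && sorted (eps_step eps) c.

Lemma based_chain0 : based_chain [:: x0].
Proof. by rewrite /based_chain /= eqxx. Qed.

Definition chain_homotopic (c c' : {c | based_chain c}) : bool :=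
  `[< eps_homotopic eps (val c) (val c') >].

Lemma chain_homotopic_refl : reflexive chain_homotopic.
Proof. by move=> c; apply/asboolP; exact: rt_refl. Qed.

Lemma chain_homotopic_sym : symmetric chain_homotopic.
Proof.
by move=> c c'; apply/idP/idP => /asboolP h; apply/asboolP; exact: eps_homotopic_sym.
Qed.

Lemma chain_homotopic_trans : transitive chain_homotopic.
Proof.
move=> b a c /asboolP h /asboolP h'; apply/asboolP.
by apply: rt_trans; eassumption.
Qed.

Canonical chain_homotopic_equiv := EquivRel chain_homotopic
  chain_homotopic_refl chain_homotopic_sym chain_homotopic_trans.

Definition chain_cover : Type := {eq_quot chain_homotopic}.

HB.instance Definition _ := Choice.on chain_cover.

(** Total on sequences, so that appending points needs no proof arguments; a
    sequence that is not a based chain is sent to the class of the constant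
    chain. *)
Definition chain_class (c : seq X) : chain_cover :=
  \pi_{eq_quot chain_homotopic}%qT (insubd (Sub [:: x0] based_chain0) c).

Definition chain_rep (e : chain_cover) : seq X :=
  val (repr (e : {eq_quot chain_homotopic})).

Lemma chain_rep_based e : based_chain (chain_rep e).
Proof. exact: valP. Qed.

Lemma chain_repK e : chain_class (chain_rep e) = e.
Proof. by rewrite /chain_class /chain_rep valKd reprK. Qed.

Lemma chain_class_eq c c' : based_chain c -> based_chain c' ->
  chain_class c = chain_class c' <-> eps_homotopic eps c c'.
Proof.
move=> bc bc'; rewrite /chain_class; split.
  by move/eqmodP/asboolP; rewrite /= !insubdK.
by move=> h; apply/eqmodP/asboolP; rewrite !insubdK.
Qed.

Lemma chain_rep_homotopic c : based_chain c ->
  eps_homotopic eps c (chain_rep (chain_class c)).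
Proof.
move=> bc; apply/chain_class_eq => //; first exact: chain_rep_based.
by rewrite chain_repK.
Qed.

Definition tip (e : chain_cover) : X := last x0 (chain_rep e).

Definition extend (e : chain_cover) (y : X) : chain_cover :=
  chain_class (rcons (chain_rep e) y).

Lemma based_chain_neq0 c : based_chain c -> c <> [::].
Proof. by case: c. Qed.

Lemma based_chain_eps_chain c : based_chain c -> eps_chain eps c.
Proof. by move=> /[dup]/based_chain_neq0 ? /andP[_ ?]. Qed.

Lemma based_chain_rcons c y : based_chain c ->
  based_chain (rcons c y) = (mdist (last x0 c) y < eps).
Proof.
move=> /[dup]/based_chain_neq0 c0 /andP[h s]; rewrite /based_chain.
rewrite (sorted_rcons _ x0)// s /=.
by case: c h c0 {s} => //= x c ->.
Qed.

Lemma tip_chain_class c : based_chain c -> tip (chain_class c) = last x0 c.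
Proof.
by move=> /chain_rep_homotopic/eps_homotopic_endpoints/(last_endpoints x0).
Qed.

Lemma last_based d c : based_chain c -> last d c = last x0 c.
Proof. by case: c. Qed.

Lemma chain_class_rcons c y : based_chain c -> mdist (last x0 c) y < eps ->
  extend (chain_class c) y = chain_class (rcons c y).
Proof.
move=> bc cy; have br := chain_rep_based (chain_class c).
have tc : last x0 (chain_rep (chain_class c)) = last x0 c := tip_chain_class bc.
apply/esym/chain_class_eq; rewrite ?based_chain_rcons ?tc//.
- apply: eps_homotopic_rcons; last exact: chain_rep_homotopic.
  by rewrite last_based.
Qed.

Hypothesis eps0 : 0 < eps.

(** The identity law removes a repeated last point, and the triangle law is the
    removal of the last but one point: both are basic moves. *)
Lemma extend_action : local_action eps tip extend.
Proof.
split.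
- move=> e y; rewrite /tip => h; rewrite -/(tip (extend e y)) /extend.
  by rewrite tip_chain_class ?last_rcons// based_chain_rcons//; exact: chain_rep_based.
- move=> e; rewrite -[RHS]chain_repK; have be := chain_rep_based e.
  have te : mdist (last x0 (chain_rep e)) (tip e) < eps by rewrite /tip mdistxx.
  apply/chain_class_eq => //; first by rewrite based_chain_rcons.
  apply: rt_step; split.
  + by apply: based_chain_eps_chain; rewrite based_chain_rcons.
  + exact: based_chain_eps_chain.
  + by rewrite /tip; case: chain_rep be => //= x s _; rewrite last_rcons.
  + by right; exists (chain_rep e), (tip e), [::]; rewrite cats0 cats1.
- move=> e x y ex xy ey; have be := chain_rep_based e.
  have bx : based_chain (rcons (chain_rep e) x) by rewrite based_chain_rcons.
  rewrite {2}/extend chain_class_rcons ?last_rcons//; apply/chain_class_eq.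
  + by rewrite based_chain_rcons// last_rcons.
  + by rewrite based_chain_rcons.
  apply: rt_step; split.
  + by apply: based_chain_eps_chain; rewrite based_chain_rcons ?last_rcons.
  + by apply: based_chain_eps_chain; rewrite based_chain_rcons.
  + by case: chain_rep be => //= u s _; rewrite !last_rcons.
  + right; exists (chain_rep e), x, [:: y]; split; first by rewrite cats1.
    by rewrite -!cats1 -catA.
Qed.

Lemma chain_class_foldl c : based_chain c ->
  chain_class c = foldl extend (chain_class [:: x0]) (behead c).
Proof.
case: c => // x s bc; move: (bc); rewrite /based_chain => /andP[/eqP[ex] _].
rewrite {}ex in bc *; elim/last_ind: s bc => //= s y ih.
rewrite -rcons_cons => h.
have bs : based_chain (x0 :: s).
  by move: h; rewrite /based_chain /= eqxx rcons_path => /andP[_ /andP[->]].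
move: h; rewrite based_chain_rcons// => h.
by rewrite foldl_rcons -ih// chain_class_rcons.
Qed.

End ChainCover.

(** * Geodesics and balls *)
Section Geodesics.
Context {R : realType} {X : metricType R}.

Lemma ballP (x y : X) (r : R) : ball x r y <-> mdist x y < r.
Proof. by rewrite ballEmdist. Qed.

Lemma mdist_ball_open (x : X) (r : R) : open (ball x r).
Proof.
rewrite openE => y /ballP xy; apply/nbhs_ballP.
exists (r - mdist x y) => /=; first by rewrite subr_gt0.
move=> z /ballP yz; apply/ballP.
by apply: le_lt_trans (metric_triangle _ y _) _; rewrite -ltrBrDl.
Qed.

(** The partition of the segment by t alone gives a lower bound of the length. *)
Lemma geodesic_between (a b t : R) (g : R -> X) :
  curve_length a b g = (mdist (g a) (g b))%:E -> t \in `[a, b] ->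
  mdist (g a) (g t) + mdist (g t) (g b) <= mdist (g a) (g b).
Proof.
move=> gl; rewrite in_itv /= !le_eqVlt => /andP[/orP[/eqP ->|lat]].
  by rewrite mdistxx add0r eqxx.
case/orP=> [/eqP <-|tb].
  by rewrite mdistxx addr0 eqxx.
rewrite -le_eqVlt -lee_fin -gl; apply: ereal_sup_ubound; exists [:: t; b].
  by split; rewrite /= ?lat ?tb.
by rewrite !big_ord_recl big_ord0 /= addr0.
Qed.

Lemma geodesic_ball (x : X) (r : R) (a b : R) (g : R -> X) :
  g a = x -> curve_length a b g = (mdist (g a) (g b))%:E ->
  ball x r (g b) -> g @` `[a, b] `<=` ball x r.
Proof.
move=> gx gl /ballP h _ [t /= tab <-]; apply/ballP; rewrite -gx in h *.
apply: le_lt_trans h; apply: le_trans (geodesic_between gl tab).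
by rewrite lerDl mdist_ge0.
Qed.

Hypothesis Xgeo : geodesic_space X.

(** A geodesic from the centre to a point of the ball stays in the ball. *)
Lemma ball_connected (x : X) (r : R) : connected (ball x r).
Proof.
rewrite (_ : ball x r =
  \bigcup_(C in [set C | [/\ connected C, C x & C `<=` ball x r]]) C).
  by apply: bigcup_connected => [|C []//]; exists x => C [].
apply/seteqP; split=> y; last by case=> C [_ _]; apply.
move=> xy; have [a [b [g [ab cg ga gb gl]]]] := Xgeo x y.
have ain : `[a, b]%classic a by rewrite /= in_itv /= lexx.
have bin : `[a, b]%classic b by rewrite /= in_itv /= lexx ab.
exists (g @` `[a, b]%classic); last by exists b.
split; last by apply: geodesic_ball => //; rewrite ?ga ?gb//.
- exact: connected_continuous_connected (@segment_connected _ _ _) cg.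
- by exists a.
Qed.

Lemma geodesic_connected : connected [set: X].
Proof.
have [[x _]|] := pselect ([set: X] !=set0); last first.
  by move/set0P/negP; rewrite negbK => /eqP ->; exact: connected0.
rewrite (_ : [set: X] = \bigcup_(r in [set r | 0 < r]) ball x r).
  apply: bigcup_connected => [|r _]; last exact: ball_connected.
  by exists x => r /= r0; apply: ballxx.
apply/seteqP; split=> // y _; exists (mdist x y + 1).
  by rewrite /= ltr_wpDl// mdist_ge0.
by apply/ballP; rewrite ltrDl.
Qed.

End Geodesics.

(** * The chain cover *)
Section ChainCoverTopology.
Context {R : realType} {X : metricType R}.
Variables (x0 : X) (eps : R).
Notation T := (chain_cover x0 eps).

(** The topology in which the classes obtained from e by appending a point
    close to the end of e form a neighbourhood basis at e. *)
Definition chain_cover_open (A : set T) := forall e, A e -> exists2 r, 0 < r &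
  forall y, mdist (tip e) y < r -> mdist (tip e) y < eps -> A (extend e y).

Lemma chain_cover_openT : chain_cover_open setT.
Proof. by move=> e _; exists 1. Qed.

Lemma chain_cover_openI : setI_closed chain_cover_open.
Proof.
move=> A B oA oB e [/oA [r r0 Ar] /oB [s s0 Bs]].
exists (Num.min r s); first by rewrite lt_min r0.
by move=> y; rewrite lt_min => /andP[yr ys] ye; split; [exact: Ar|exact: Bs].
Qed.

Lemma chain_cover_open_bigcup (I : Type) (f : I -> set T) :
  (forall i, chain_cover_open (f i)) -> chain_cover_open (\bigcup_i f i).
Proof.
move=> fo e [i _ /fo [r r0 h]]; exists r => // y yr ye.
by exists i => //; exact: h.
Qed.

HB.instance Definition _ := isOpenTopological.Build T
  chain_cover_openT chain_cover_openI chain_cover_open_bigcup.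

Lemma open_chain_coverE (A : set T) : open A = chain_cover_open A.
Proof. by []. Qed.

End ChainCoverTopology.

Section ChainCoverCovering.
Context {R : realType} {X : metricType R}.
Variables (x0 : X) (eps : R).
Hypotheses (eps0 : 0 < eps) (Xgeo : geodesic_space X).
Notation T := (chain_cover x0 eps).
Let act : local_action eps (@tip R X x0 eps) (@extend R X x0 eps) :=
  extend_action x0 eps0.

(** By [sheet_sym], a class is recovered from any point of its sheet and its own
    endpoint, so the sheets of distinct classes with one endpoint are
    disjoint. *)
Definition sheet (e : T) : set T := extend e @` ball (tip e) eps.

Lemma sheetP (e f : T) : sheet e f <->
  mdist (tip e) (tip f) < eps /\ f = extend e (tip f).
Proof.
split=> [[y /ballP ey <-]|[h ->]]; first by rewrite (act_tip act).
by exists (tip f) => //; apply/ballP.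
Qed.

Lemma sheet_refl e : sheet e e.
Proof. by apply/sheetP; rewrite mdistxx (act_id act). Qed.

Lemma sheet_sym e f : sheet e f -> sheet f e.
Proof.
move=> /sheetP[h ->]; apply/sheetP; rewrite (act_tip act)// metric_sym; split=> //.
by rewrite (act_tri act) ?(act_id act)// ?mdistxx// metric_sym.
Qed.

Lemma open_sheet e : open (sheet e).
Proof.
rewrite open_chain_coverE => f /sheetP[h fe].
exists (eps - mdist (tip e) (tip f)); first by rewrite subr_gt0.
move=> y fy fy'; have ey : mdist (tip e) y < eps.
  by apply: le_lt_trans (metric_triangle _ (tip f) _) _; rewrite -ltrBrDl.
by apply/sheetP; rewrite !(act_tip act)//; split=> //; rewrite fe (act_tri act).
Qed.

Lemma tip_continuous : continuous (@tip R X x0 eps).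
Proof.
apply/continuousP => A oA; rewrite open_chain_coverE => e Ae.
have /nbhs_ballP[r /= r0 rA] := open_nbhs_nbhs (conj oA Ae).
by exists r => // y yr ye; rewrite /preimage /= (act_tip act)//; apply: rA; apply/ballP.
Qed.

Lemma extend_continuous (e : T) : {within ball (tip e) eps, continuous (extend e)}.
Proof.
rewrite continuous_open_subspace; last exact: mdist_ball_open.
move=> y /set_mem/ballP ey A; rewrite /= nbhsE => -[B [oB Be] BA].
have [r r0 h] := oB _ Be; rewrite (act_tip act)// in h.
apply/nbhs_ballP; exists (Num.min r (eps - mdist (tip e) y)) => /=.
  by rewrite lt_min r0 subr_gt0.
move=> z /ballP; rewrite lt_min => /andP[zr ze]; apply: BA.
have ez : mdist (tip e) z < eps.
  by apply: le_lt_trans (metric_triangle _ y _) _; rewrite -ltrBrDl.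
have yz : mdist y z < eps by rewrite (lt_le_trans ze)// gerBl mdist_ge0.
by have := h z zr yz; rewrite (act_tri act).
Qed.

Lemma sheet_connected (e : T) : connected (sheet e).
Proof.
apply: connected_continuous_connected; first exact: ball_connected.
exact: extend_continuous.
Qed.

Lemma homeo_sheet e : homeo_between (@tip R X x0 eps) (sheet e) (ball (tip e) eps).
Proof.
split.
- split.
  + by move=> f /sheetP[h _]; apply/ballP.
  + move=> f f' /set_mem/sheetP[_ fe] /set_mem/sheetP[_ fe'] ff'.
    by rewrite fe fe' ff'.
  + move=> y /ballP ey; exists (extend e y); last exact: (act_tip act).
    by exists y => //; apply/ballP.
- exact/continuous_subspaceT/tip_continuous.
- exists (extend e); split; first exact: extend_continuous.
  by move=> f /set_mem/sheetP[_ <-].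
Qed.

(** A class is joined to that of the constant chain through the sheets of its
    initial subchains, and these are connected. *)
Lemma chain_cover_connected : connected [set: T].
Proof.
move=> B [e0 Be0] [C oC BC] [D cD BD]; rewrite setTI in BC; rewrite setTI in BD.
have oB : open B by rewrite BC.
have cB : closed B by rewrite BD.
have sub e f : B e -> sheet e f -> B f.
  move=> Be; suff <- : sheet e `&` B = sheet e by case.
  by apply: (@sheet_connected e);
    [exists e; split=> //; exact: sheet_refl|exists B|exists B].
have base e : B e <-> B (chain_class x0 eps [:: x0]).
  have := chain_rep_based e; rewrite -[e in B e]chain_repK => be.
  rewrite chain_class_foldl//; case: (chain_rep e) be => // x s /andP[/eqP[/= ->]].
  have : x0 = tip (chain_class x0 eps [:: x0]) by rewrite tip_chain_class// based_chain0.
  move: (chain_class x0 eps [:: x0]) => e1 {1}->.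
  elim: s e1 => //= y s ih e1 /andP[ey ys].
  rewrite ih ?(act_tip act)//; have h : sheet e1 (extend e1 y).
    by exists y => //; apply/ballP.
  split=> h'; [exact: sub h' (sheet_sym h)|exact: sub h' h].
apply/seteqP; split=> // e _; apply/base; exact: (iffLR (base e0) Be0).
Qed.

(** The ball of radius eps about x is evenly covered by the sheets of the
    classes that end at x. *)
Lemma chain_cover_cover : Defs.cover (@tip R X x0 eps).
Proof.
split; last exact: chain_cover_connected.
(* The image of the projection is a union of balls, and so is its complement. *)
have onto x : exists e : T, tip e = x.
  suff : [set tip e | e in [set: T]] = [set: X].
    by move/seteqP => [_ /(_ x Logic.I) [e _ <-]]; exists e.
  apply: (geodesic_connected Xgeo).
  - by exists (tip (chain_class x0 eps [:: x0])); exists (chain_class x0 eps [:: x0]).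
  - exists [set tip e | e in [set: T]]; last by rewrite setTI.
    rewrite openE => _ [e _ <-]; apply/nbhs_ballP; exists eps => // y /ballP ey.
    by exists (extend e y) => //; exact: (act_tip act).
  - exists [set tip e | e in [set: T]]; last by rewrite setTI.
    rewrite -openC openE => y ny; apply/nbhs_ballP; exists eps => // z /ballP yz [e _ ez].
    apply: ny; exists (extend e y) => //; apply: (act_tip act).
    by rewrite ez metric_sym.
split.
- exact: tip_continuous.
- by move=> x _; have [e ex] := onto x; exists e.
move=> x; exists (ball x eps); split; [exact: mdist_ball_open|exact: ballxx|].
exists [set sheet e | e in [set e | tip e = x]]; split.
- apply/seteqP; split=> [f /ballP xf|f [_ [e /= ex <-] /sheetP[ef _]]]; last first.
    by apply/ballP; rewrite -ex.
  have ftx : tip (extend f x) = x by rewrite (act_tip act)// metric_sym.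
  exists (sheet (extend f x)); first by exists (extend f x).
  by apply: sheet_sym; exists x => //; apply/ballP; rewrite metric_sym.
- move=> _ _ [e /= ex <-] [e' /= ex' <-] [f [ef ef']].
  move/sheet_sym/sheetP: ef ef' => [_ ef] /sheet_sym/sheetP[_ ef'].
  by rewrite ef ef' ex ex'.
- move=> _ [e /= ex <-]; split; first exact: open_sheet.
  by rewrite -ex; exact: homeo_sheet.
Qed.

End ChainCoverCovering.

(** * Covers of a compact geodesic space *)
Section HomeoCover.
Context {Y X : topologicalType}.

Lemma homeomorphism_cover (f : Y -> X) (s : X -> Y) :
  continuous f -> continuous s -> cancel f s -> cancel s f ->
  connected [set: Y] -> Defs.cover f.
Proof.
move=> cf cs fs sf Yc; split=> //; split=> // [x _|x]; first by exists (s x).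
exists setT; split=> //; first exact: openT.
exists [set [set: Y]]; split.
- by rewrite bigcup_set1 preimage_setT.
- by move=> _ _ -> ->.
- move=> _ ->; split; first exact: openT.
  split; [split=> //|exact: continuous_subspaceT|].
  + by move=> y y' _ _ /(congr1 s); rewrite !fs.
  + by move=> v _; exists (s v).
  + by exists s; split; [exact: continuous_subspaceT|move=> y _; rewrite fs].
Qed.

(** A connected set over an evenly covered set lies in a single sheet, since
    the other sheets have an open union. *)
Lemma evenly_covered_inj (f : Y -> X) (U : set X) (C : set Y) (z w : Y) :
  evenly_covered f U -> connected C -> f @` C `<=` U -> C z -> C w ->
  f z = f w -> z = w.
Proof.
case=> S [fU tS SU] Cc CU Cz Cw zw.
have inU v : C v -> (\bigcup_(V in S) V) v by move=> Cv; rewrite -fU; apply: CU; exists v.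
have [V SV Vz] := inU _ Cz; have [oV [[_ iV _] _ _]] := SU _ SV.
suff CV : C `&` V = C.
  have [_ Vw] : (C `&` V) w by rewrite CV.
  by apply: iV => //; apply/mem_set.
apply: Cc; [by exists z|by exists V|].
exists (~` \bigcup_(W in S `&` [set W | W != V]) W).
  apply: open_closedC; apply: bigcup_open => W [SW _].
  by have [] := SU _ SW.
apply/seteqP; split=> v [Cv].
  move=> Vv; split=> // -[W [SW /eqP WV] Wv]; apply: WV.
  by apply: tS => //; exists v.
move=> nv; split=> //; have [W SW Wv] := inU _ Cv.
have [<-//|WV] := eqVneq W V.
by case: nv; exists W.
Qed.

End HomeoCover.

Section CoverAction.
Context {R : realType} {X : metricType R} {Z : topologicalType}.
Variables (g : Z -> X).
Hypotheses (Xgeo : geodesic_space X) (Xcpt : compact [set: X]).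
Hypothesis gcov : Defs.cover g.

(** The scale is doubled because the triangles used in [adjacent_trans] lie in a
    ball of twice the radius of a single step. *)
Lemma lebesgue_number : exists2 eps, 0 < eps & forall x : X,
  exists2 U, evenly_covered g U & ball x (eps + eps) `<=` U.
Proof.
have [[_ _ loc] _] := gcov.
move/compact_near_coveringP : Xcpt => /(_ R (0^'+)
  (fun e x => exists2 U, evenly_covered g U & ball x (e + e) `<=` U) _) H.
have /filter_ex [e [e0 he]] : \forall e \near (0 : R)^'+, 0 < e /\
    forall x, exists2 U, evenly_covered g U & ball x (e + e) `<=` U.
  near=> e; split; first by near: e; exact: nbhs_right_gt.
  move=> x; suff : [set: X] `<=` fun x =>
    exists2 U, evenly_covered g U & ball x (e + e) `<=` U by exact.
  near: e; apply: H => y _; have [U [oU Uy eU]] := loc y.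
  have /nbhs_ballP[r /= r0 rU] := open_nbhs_nbhs (conj oU Uy).
  exists (ball y (r / 2), [set e | e < r / 4]).
    split; first by apply: nbhsx_ballx; rewrite divr_gt0.
    by apply: nbhs_right_lt; rewrite divr_gt0.
  move=> [x' e'] /= [/ballP yx' er]; exists U => // v /ballP xv; apply: rU.
  by apply/ballP; have := metric_triangle y x' v; lra.
by exists e.
Unshelve. all: by end_near. Qed.

Variable eps : R.
Hypothesis eps0 : 0 < eps.
Hypothesis leb : forall x : X,
  exists2 U, evenly_covered g U & ball x (eps + eps) `<=` U.

(** A connected set over a ball replaces the lift of a path in the ball. *)
Definition adjacent (z w : Z) : Prop := exists C : set Z,
  [/\ connected C, C z, C w & g @` C `<=` ball (g z) eps].

Definition cover_act (z : Z) (y : X) : Z :=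
  xget z [set w | adjacent z w /\ g w = y].

Lemma adjacent_mdist z w : adjacent z w -> mdist (g z) (g w) < eps.
Proof. by case=> C [_ _ Cw CU]; apply/ballP/CU; exists w. Qed.

(** The sheet through z provides both a neighbourhood of points adjacent to z
    and, through its section s, a point adjacent to z over each point of the
    ball: the lifted ball is the connected set required. *)
Lemma adjacent_chart z : exists O : set Z, exists s : X -> Z,
  [/\ nbhs z O, forall w, O w -> adjacent z w &
      forall y, mdist (g z) y < eps -> adjacent z (s y) /\ g (s y) = y].
Proof.
have [[gcont _ _] _] := gcov.
have [U [S [gU _ SU]] BU] := leb (g z).
have BU' : ball (g z) eps `<=` U.
  move=> y /ballP zy; apply: BU; apply/ballP; rewrite (lt_trans zy)//.
  by rewrite ltrDl.
have : (\bigcup_(V in S) V) z by rewrite -gU; apply: BU'; exact: ballxx.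
case=> V SV Vz; have [oV [[_ _ sV] _ [s [cs sK]]]] := SU _ SV.
have gsU y : U y -> g (s y) = y.
  by move=> /sV [v Vv <-]; rewrite sK//; exact: mem_set.
have adj y : mdist (g z) y < eps -> adjacent z (s y).
  move=> /ballP zy; exists (s @` ball (g z) eps); split.
  - apply: connected_continuous_connected; first exact: ball_connected.
    exact: continuous_subspaceW cs.
  - by exists (g z); [exact: ballxx|rewrite sK//; exact: mem_set].
  - by exists y.
  - by move=> _ [_ [v zv <-] <-]; rewrite gsU//; exact: BU'.
exists (V `&` g @^-1` ball (g z) eps), s; split.
- apply: open_nbhs_nbhs; split; last by split=> //; exact: ballxx.
  apply: openI => //; apply: open_comp => [? _|]; first exact: gcont.
  exact: mdist_ball_open.
- move=> w [Vw /ballP zw]; rewrite -(sK w); last exact: mem_set.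
  exact: adj.
- by move=> y zy; split; [exact: adj|apply/gsU/BU'/ballP].
Qed.

Lemma connected_lift_unique (x : X) (C : set Z) z w : connected C ->
  g @` C `<=` ball x (eps + eps) -> C z -> C w -> g z = g w -> z = w.
Proof.
have [U eU BU] := leb x => Cc CB; apply: (evenly_covered_inj eU Cc).
exact: subset_trans BU.
Qed.

Lemma adjacent_unique z w w' : adjacent z w -> adjacent z w' ->
  g w = g w' -> w = w'.
Proof.
move=> [C [Cc Cz Cw CB]] [C' [Cc' Cz' Cw' CB']].
apply: (@connected_lift_unique (g z) (C `|` C')).
- by apply: connectedU => //; exists z.
- have sub : ball (g z) eps `<=` ball (g z) (eps + eps).
    by apply: le_ball; rewrite lerDl ltW.
  by rewrite image_setU => y [/CB|/CB'] /sub.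
- by left.
- by right.
Qed.

Lemma adjacent_refl z : adjacent z z.
Proof.
exists [set z]; split=> //; first exact: connected1.
by move=> _ [_ -> <-]; exact: ballxx.
Qed.

Lemma cover_actE z w : adjacent z w -> cover_act z (g w) = w.
Proof.
move=> zw; rewrite /cover_act; case: xgetP => [v _ [zv vw]|/(_ w) []//].
exact: adjacent_unique zv zw vw.
Qed.

Lemma cover_act_adjacent z y : mdist (g z) y < eps ->
  adjacent z (cover_act z y) /\ g (cover_act z y) = y.
Proof.
move=> zy; have [_ [s [_ _ /(_ _ zy) [h h']]]] := adjacent_chart z.
by rewrite -{1 2}h' cover_actE.
Qed.

(** Close the triangle by the point v' over [g v] adjacent to z: the union of
    the three connected sets contains v and v' and lies over one evenly covered
    ball, whence v = v'. *)
Lemma adjacent_trans z w v : adjacent z w -> adjacent w v ->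
  mdist (g z) (g v) < eps -> adjacent z v.
Proof.
move=> zw wv /cover_act_adjacent; set v' := cover_act _ _ => -[zv' vv'].
suff -> : v = v' by [].
have zwd := adjacent_mdist zw; have sub (a : X) :
    mdist (g z) a < eps -> ball a eps `<=` ball (g z) (eps + eps).
  move=> za b /ballP ab; apply/ballP.
  by rewrite (le_lt_trans (metric_triangle _ a _))// ltrD.
move: zw wv zv' => [C [Cc Cz Cw CB]] [D [Dc Dw Dv DB]] [E [Ec Ez Ev EB]].
apply: (@connected_lift_unique (g z) ((C `|` D) `|` E)).
- apply: connectedU => //; first by exists z; split=> //; left.
  by apply: connectedU => //; exists w.
- rewrite !image_setU => y [[/CB|/DB]|/EB]; apply: sub => //; by rewrite mdistxx.
- by left; right.
- by right.
- by [].
Qed.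

Lemma adjacent_sym z w : adjacent z w -> adjacent w z.
Proof.
move=> zw; have := adjacent_mdist zw; rewrite metric_sym.
move=> /cover_act_adjacent; set v := cover_act _ _ => -[wv vz].
suff -> : z = v by [].
apply: adjacent_unique (adjacent_refl z) (adjacent_trans zw wv _) _ => //.
by rewrite vz mdistxx.
Qed.

Lemma cover_local_action : local_action eps g cover_act.
Proof.
split.
- by move=> z y /cover_act_adjacent[].
- by move=> z; apply: cover_actE; exact: adjacent_refl.
- move=> z x y zx xy zy; have [zx' ex] := cover_act_adjacent zx.
  have [xy' ey] : adjacent (cover_act z x) (cover_act (cover_act z x) y) /\
      g (cover_act (cover_act z x) y) = y by apply: cover_act_adjacent; rewrite ex.
  by rewrite -{2}ey cover_actE//; apply: adjacent_trans zx' xy' _; rewrite ey.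
Qed.

(** The set of points reached from z is open and closed, as it contains with a
    point everything adjacent to it. *)
Lemma cover_act_transitive z z' : exists2 s,
  path (eps_step eps) (g z) s & foldl cover_act z s = z'.
Proof.
pose B := [set z' | exists2 s,
  path (eps_step eps) (g z) s & foldl cover_act z s = z'].
have step v w : B v -> adjacent v w -> B w.
  move=> [s ps sv] vw; exists (rcons s (g w)).
    rewrite rcons_path ps /= -(act_foldl_tip cover_local_action ps) sv.
    exact: adjacent_mdist.
  by rewrite foldl_rcons sv cover_actE.
have nb v : nbhs v (adjacent v).
  by have [N [_ [nO adj _]]] := adjacent_chart v; apply: filterS nO.
have oB : open B by rewrite openE => v Bv; apply: filterS (nb v) => w; exact: step.
have cB : closed B.
  rewrite -openC openE => v nBv; apply: filterS (nb v) => w vw Bw.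
  by apply: nBv; apply: step Bw _; exact: adjacent_sym.
have [_ Zc] := gcov.
suff BT : B = setT by have : B z' by rewrite BT.
apply: Zc; [by exists z, [::]|by exists B; rewrite ?setTI..].
Qed.

End CoverAction.

Section SimplyChained.
Context {R : realType} {X : metricType R}.
Variable x0 : X.
Hypotheses (Xgeo : geodesic_space X) (Xcpt : compact [set: X]).
Hypothesis null : loops_null x0.

(** Transport two points of one fibre along a chain to the fibre of the base
    point.  There the images are joined by the action of a loop, which is null
    and so acts trivially; transport along a chain is injective. *)
Lemma cover_injective (Z : topologicalType) (g : Z -> X) :
  Defs.cover g -> injective g.
Proof.
move=> gcov z z' zz'; have [eps eps0 leb] := lebesgue_number Xcpt gcov.
have A := cover_local_action Xgeo gcov eps0 leb.
have tr := cover_act_transitive Xgeo gcov eps0 leb.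
have [[_ /(_ x0 Logic.I) [z0 _ gz0] _] _] := gcov.
have [t pt tz0] := tr z z0.
have pt' : path (eps_step eps) (g z') t by rewrite -zz'.
apply: (act_foldl_inj A zz' pt); rewrite tz0.
have tip0 := act_foldl_tip A pt; rewrite tz0 gz0 in tip0.
have := act_foldl_tip A pt'; rewrite -zz' -tip0.
move: (foldl _ z' t) => z1 gz1.
have [s ps sz1] := tr z0 z1; rewrite gz0 in ps.
have l : eps_loop x0 eps (x0 :: s).
  split; first by split.
  rewrite /=; congr (Some (_, _)).
  by rewrite -[in LHS]gz0 -(act_foldl_tip A) ?gz0// sz1.
have := act_foldl_homotopic A (null eps0 l) (z := z0).
rewrite /= gz0 => /(_ erefl); have := act_id A z0.
by rewrite gz0 => -> e; rewrite -sz1 e.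
Qed.

(** The inverse of a bijective cover agrees locally with the sections of the
    sheets, hence is continuous. *)
Lemma null_universal_cover : universal_cover (@idfun X).
Proof.
split.
  have idc : continuous (@idfun X) by move=> x; exact: cvg_id.
  by apply: (@homeomorphism_cover _ _ _ idfun) => //; exact: geodesic_connected.
move=> Z g gcov; have ginj := cover_injective gcov.
have [[gc gs loc] _] := gcov.
pose h (x : X) : Z := s2val (cid2 (gs x Logic.I)).
have gh x : g (h x) = x by rewrite /h; case: cid2.
have hg z : h (g z) = z by exact: ginj.
have hc : continuous h.
  move=> x; have [U [oU Ux [S [gU _ SU]]]] := loc x.
  have : (\bigcup_(V in S) V) (h x) by rewrite -gU /preimage /= gh.
  case=> V SV _; have [_ [[_ _ sV] _ [s [cs sK]]]] := SU _ SV.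
  have hs y : U y -> h y = s y.
    by move=> /sV[v Vv <-]; rewrite hg sK//; exact: mem_set.
  have cs' : {within U, continuous h}.
    by apply: subspace_eq_continuous cs => y /set_mem Uy; exact/esym/hs.
  by move: cs'; rewrite continuous_open_subspace// => /(_ x (mem_set Ux)).
exists h; split; last by apply/funext => x /=; rewrite gh.
by apply: (homeomorphism_cover hc gc gh hg); exact: geodesic_connected.
Qed.

End SimplyChained.

(** A cover is surjective, so the map that the universal property provides into
    the chain cover is a surjective section of the projection, which is thus
    injective. *)
Lemma universal_cover_null (R : realType) (X : metricType R) (x0 : X) :
  geodesic_space X -> universal_cover (@idfun X) -> loops_null x0.
Proof.
move=> Xgeo [_ U] eps c eps0 [[c0 sc] ec].
have [h [[[_ hs _] _] th]] := U _ _ (@chain_cover_cover _ _ x0 _ eps0 Xgeo).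
have tip_inj : injective (@tip R X x0 eps).
  move=> e e'; have [x _ <-] := hs e Logic.I; have [x' _ <-] := hs e' Logic.I.
  have thE y : tip (h y) = y by rewrite -[RHS]/(idfun y) -th.
  by rewrite !thE => ->.
have bc : based_chain x0 eps c.
  by rewrite /based_chain sc andbT; case: (c) ec => //= x s [-> _].
apply/(chain_class_eq bc (based_chain0 _ _))/tip_inj.
rewrite !tip_chain_class ?based_chain0//.
by case: (c) ec => //= x s [-> ->].
Qed.

(** * Critical values *)
Section Critical.
Context {R : realType} {X : metricType R}.
Implicit Types (eps : R) (x : X) (c s : seq X).

Lemma eps_class_eq (x0 : X) eps c c' : eps_loop x0 eps c -> eps_loop x0 eps c' ->
  eps_class x0 eps c = eps_class x0 eps c' <-> eps_homotopic eps c c'.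
Proof.
move=> lc lc'; split=> [cc'|h].
  have : eps_class x0 eps c' c' by split=> //; exact: rt_refl.
  by rewrite -cc' => -[].
apply/seteqP; split=> d [ld hd]; split=> //; apply: rt_trans hd => //.
exact: eps_homotopic_sym.
Qed.

Lemma trivial_loop (x0 : X) eps : eps_loop x0 eps [:: x0].
Proof. by split; first by split. Qed.

Lemma eps_nullP (x0 : X) eps c : eps_loop x0 eps c ->
  eps_null x0 eps c <-> eps_homotopic eps c [:: x0].
Proof. by move=> lc; apply: eps_class_eq => //; exact: trivial_loop. Qed.

Lemma eps_loop_weaken (x0 : X) eps eps' c : eps <= eps' ->
  eps_loop x0 eps c -> eps_loop x0 eps' c.
Proof.
move=> le [[c0 sc] ec]; split=> //; split=> //.
by apply: sub_sorted sc => u v /lt_le_trans; apply.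
Qed.

Lemma eps_chain_shrink eps c : eps_chain eps c ->
  exists2 eps', eps' < eps & eps_chain eps' c.
Proof.
case=> c0 sc; suff [e ee se] : exists2 e, e < eps & sorted (eps_step e) c.
  by exists e.
case: c sc {c0} => [_|x s] /=; first by exists (eps - 1); rewrite ?ltrBlDr ?ltrDl.
elim: s x => [x _|y s ih x /= /andP[xy /ih [e ee ps]]].
  by exists (eps - 1); rewrite ?ltrBlDr ?ltrDl.
exists (Num.max e ((mdist x y + eps) / 2)).
  by rewrite gt_max ee /=; lra.
rewrite /= lt_max; apply/andP; split; first by apply/orP; right; lra.
by apply: sub_path ps => u v h; rewrite lt_max h.
Qed.

(** Finitely many strict inequalities hold with some room. *)
Lemma eps_homotopic_shrink eps c c' : eps_homotopic eps c c' ->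
  exists2 eps', eps' < eps & eps_homotopic eps' c c'.
Proof.
elim=> [a b [ca cb e h]|a|a b d _ [e ee ab] _ [e' ee' bd]].
- have [e1 l1 c1] := eps_chain_shrink ca.
  have [e2 l2 c2] := eps_chain_shrink cb.
  exists (Num.max e1 e2); first by rewrite gt_max l1.
  apply: rt_step; split=> //.
  + case: c1 => a0 s1; split=> //.
    by apply: sub_sorted s1 => u v w; rewrite lt_max w.
  + case: c2 => a0 s1; split=> //.
    by apply: sub_sorted s1 => u v w; rewrite lt_max w orbT.
- by exists (eps - 1); [rewrite ltrBlDr ltrDl|exact: rt_refl].
- exists (Num.max e e'); first by rewrite gt_max ee.
  by apply: rt_trans; [apply: eps_homotopic_weaken ab|apply: eps_homotopic_weaken bd];
    rewrite le_max lexx ?orbT.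
Qed.

(** Points at distance less than eps from the base point can be removed one
    after the other, next to the base point. *)
Lemma cone_null (x0 : X) eps s : path (eps_step eps) x0 s ->
  all (fun y => mdist x0 y < eps) s -> last x0 s = x0 ->
  eps_homotopic eps (x0 :: s) [:: x0].
Proof.
elim: s => [_ _ _|y s ih /= /andP[xy ps] /andP[_ near_s] l]; first exact: rt_refl.
have p' : path (eps_step eps) x0 s.
  by case: s near_s ps {ih l} => //= z s /andP[-> _] /andP[_ ->].
have l' : last x0 s = x0 by case: s l {ih near_s ps p'}.
apply: rt_trans (ih p' near_s l'); apply: rt_step; split.
- by split=> //=; rewrite xy.
- by split.
- by rewrite /= l l'.
- by right; exists [:: x0], y, s.
Qed.

Lemma eps_loop_eventually_null (x0 : X) eps c : eps_loop x0 eps c ->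
  exists2 D, eps <= D & eps_homotopic D c [:: x0].
Proof.
move=> l; have [D eD aD] : exists2 D, eps <= D & all (fun y => mdist x0 y < D) c.
  elim: (c) => [|y s [D eD aD]]; first by exists eps.
  exists (Num.max D (mdist x0 y + 1)); first by rewrite le_max eD.
  rewrite /= lt_max ltrDl ltr01 orbT /=.
  by apply: sub_all aD => u w; rewrite lt_max w.
exists D => //; have [[c0 sc] ec] := eps_loop_weaken eD l.
case: c ec sc aD {l c0} => // x s /= [-> ls] ps /andP[_ near_s].
exact: cone_null.
Qed.

(** The supremum s of the scales at which a loop c is not null is attained, by
    [eps_homotopic_shrink], and so belongs to [Cr]. *)
Lemma Cr_empty_null (x0 : X) : Cr x0 = set0 <-> loops_null x0.
Proof.
split=> [C0 eps c e0 lc|N]; last first.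
  apply/seteqP; split=> // eps [e0 [c [lc nc _]]]; apply: nc.
  by apply/eps_nullP => //; exact: N.
apply: contrapT => nc.
pose S := [set d | eps <= d /\ ~ eps_homotopic d c [:: x0]].
have Seps : S eps by split.
have [D eD nD] := eps_loop_eventually_null lc.
have ubS : ubound S D.
  move=> d [_ nd]; rewrite leNgt; apply/negP => Dd; apply: nd.
  exact: eps_homotopic_weaken (ltW Dd) nD.
have hS : has_sup S by split; [exists eps|exists D].
have es : eps <= sup S := sup_upper_bound hS Seps.
suff : Cr x0 (sup S) by rewrite C0.
split; first exact: lt_le_trans es.
exists c; split; first exact: eps_loop_weaken lc.
- move/(eps_nullP (eps_loop_weaken es lc))/eps_homotopic_shrink => [e' es' h].
  have es'0 : 0 < sup S - e' by rewrite subr_gt0.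
  have [d [_ nd]] := sup_adherent es'0 hS; rewrite opprB addrC subrK => /ltW ed.
  by apply: nd; exact: eps_homotopic_weaken ed h.
- move=> d sd; apply/eps_nullP; first exact: (eps_loop_weaken (le_trans es (ltW sd)) lc).
  apply: contrapT => nd; suff : d <= sup S by rewrite leNgt sd.
  by apply: (sup_upper_bound hS); split=> //; exact: le_trans es (ltW sd).
Qed.

End Critical.

(** * Uniform continuity on compact sets *)
Section Continuity.
Context {R : realType}.

Lemma within_continuous_comp_image (T S U : topologicalType) (A : set T) (B : set S)
    (phi : T -> S) (f : S -> U) : continuous phi -> phi @` A `<=` B ->
  {within B, continuous f} -> {within A, continuous (f \o phi)}.
Proof.
move=> cphi AB /subspace_continuousP cf; apply/subspace_continuousP => x Ax W nW.
have Bx : B (phi x) by apply: AB; exists x.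
have nB : nbhs (phi x) (fun y => B y -> W (f y)) := cf _ Bx _ nW.
suff : nbhs x (fun v => A v -> W (f (phi v))) by [].
have nA : nbhs x (fun v => B (phi v) -> W (f (phi v))) := cphi x _ nB.
apply: (@filterS _ (nbhs x) _ _ _ _ nA) => v h Av.
by apply: h; apply: AB; exists v.
Qed.

Lemma compact_uniformly_continuous (T : pseudoMetricType R) (X : metricType R)
    (K : set T) (f : T -> X) (eps : R) :
  compact K -> {within K, continuous f} -> 0 < eps ->
  exists2 d, 0 < d & forall p q, K p -> K q -> ball p d q -> mdist (f p) (f q) < eps.
Proof.
move=> /compact_near_coveringP Kc /subspace_continuousP cf e0.
have := Kc R (0^'+) (fun d p => K p ->
  forall q, K q -> ball p d q -> mdist (f p) (f q) < eps) _.
move=> H; have /filter_ex [d [d0 hd]] : \forall d \near (0 : R)^'+, 0 < d /\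
    (K `<=` fun p => K p -> forall q, K q -> ball p d q -> mdist (f p) (f q) < eps).
  near=> d; split; first by near: d; exact: nbhs_right_gt.
  near: d; apply: H => x Kx.
  have : nbhs x (fun y => K y -> ball (f x) (eps / 2) (f y)).
    by apply: (cf _ Kx); apply: nbhsx_ballx; rewrite divr_gt0.
  move=> /nbhs_ballP[r /= r0 rK].
  exists (ball x (r / 2), [set e | e < r / 2]).
    by split; [apply: nbhsx_ballx|apply: nbhs_right_lt]; rewrite divr_gt0.
  move=> [p d] /= [xp dr] Kp q Kq pq.
  have xq : ball x r q.
    rewrite [r]splitr; apply: ball_triangle xp _.
    by apply: le_ball pq; exact: ltW.
  have xp' : ball x r p by apply: le_ball xp; rewrite ler_pdivrMr// ler_peMr// ?ler1n// ltW.
  have /ballP h1 := rK _ xp' Kp; have /ballP h2 := rK _ xq Kq.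
  have := metric_triangle (f p) (f x) (f q); rewrite metric_sym in h1; lra.
by exists d => // p q Kp; apply: hd.
Unshelve. all: by end_near. Qed.

(** Induction along a segment by steps shorter than d: the discrete counterpart
    of its connectedness. *)
Lemma segment_ind (d a b : R) (P : R -> Prop) : 0 < d -> a <= b -> P a ->
  (forall v w, a <= v -> v < w -> w <= b -> w - v < d -> P v -> P w) -> P b.
Proof.
move=> d0 ab Pa step.
suff H n c : a <= c -> c <= b -> c - a <= n%:R * (d / 2) -> P c.
  have h0 : 0 <= (b - a) / (d / 2) by rewrite divr_ge0// ?subr_ge0// divr_ge0// ltW.
  have := archi_boundP h0; set n := Num.bound _ => hn.
  apply: (H n) => //.
  by move: hn; rewrite ltr_pdivrMr ?divr_gt0// => /ltW.
elim: n c => [|n ih] c ac cb.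
  rewrite mul0r subr_le0 => ca; suff -> : c = a by [].
  by apply/eqP; rewrite eq_le ca.
rewrite -natr1 mulrDl mul1r => h.
have [cd|cd] := leP c (a + d / 2).
  move: ac; rewrite le_eqVlt => /orP[/eqP <- //|ac].
  by apply: step ac cb _ Pa => //; lra.
by apply: (step (c - d / 2)) => //; [lra|lra|lra|apply: ih; lra].
Qed.

End Continuity.

(** * Strong chains along paths *)
Section StrongSteps.
Context {R : realType} {X : metricType R}.
Variable eps : R.

Definition strong_step (g : R -> X) (t u : R) : bool :=
  (t < u) && `[< forall v, t <= v -> v <= u ->
    mdist (g t) (g v) < eps /\ mdist (g u) (g v) < eps >].

Lemma strong_stepP (g : R -> X) (t u : R) : strong_step g t u <->
  t < u /\ g @` `[t, u] `<=` ball (g t) eps `&` ball (g u) eps.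
Proof.
split=> [/andP[tu /asboolP h]|[tu h]].
  split=> // _ [v /= tvu <-]; move: tvu; rewrite in_itv /= => /andP[tv vu].
  by have [? ?] := h v tv vu; split; apply/ballP.
apply/andP; split=> //; apply/asboolP => v tv vu.
have [/ballP ? /ballP ?] : (ball (g t) eps `&` ball (g u) eps) (g v).
  by apply: h; exists v => //=; rewrite in_itv /= tv.
by split.
Qed.

Lemma strong_step_mdist (g : R -> X) t u : strong_step g t u ->
  mdist (g t) (g u) < eps.
Proof. by case/andP => tu /asboolP/(_ u (ltW tu) (lexx _))[]. Qed.

Lemma strong_eps_chainP (g : R -> X) (a b : R) (c : seq X) :
  strong_eps_chain eps a b g c <->
  exists ts, [/\ path (strong_step g) a ts, last a ts = b & c = map g (a :: ts)].
Proof.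
split=> [[ts [[pt /eqP lt] ce [_ _] st]]|[ts [pt lt ce]]]; exists ts.
  split=> //; apply/(pathP b) => i its; apply/strong_stepP.
  by split; [exact: (pathP b pt)|exact: (st i its)].
split=> //.
- split; last exact/eqP.
  by apply: sub_path pt => u v /andP[].
- rewrite ce; split=> //=; rewrite path_map; apply: sub_path pt => u v.
  exact: strong_step_mdist.
- by move=> i its /=; have /strong_stepP[_] := pathP b pt i its.
Qed.

Lemma strong_chain_loop (x0 : X) (g : R -> X) (c : seq X) :
  loop x0 g -> strong_eps_chain eps 0 1 g c -> eps_loop x0 eps c.
Proof.
move=> [_ g0 g1] [ts [[_ /eqP lt] -> ec _]]; split=> //.
by rewrite /= last_map g0 lt g1.
Qed.

(** Uniform continuity makes every short enough step strong. *)
Lemma strong_chain_exists (a b : R) (g : R -> X) : 0 < eps -> a <= b ->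
  {within `[a, b], continuous g} -> exists c, strong_eps_chain eps a b g c.
Proof.
move=> e0 ab cg.
have [d d0 gd] := compact_uniformly_continuous (@segment_compact _ a b) cg e0.
suff [ts pt lt] : exists2 ts, path (strong_step g) a ts & last a ts = b.
  by exists (map g (a :: ts)); apply/strong_eps_chainP; exists ts.
apply: (@segment_ind _ d a b (fun v =>
  exists2 ts, path (strong_step g) a ts & last a ts = v)) => //.
  by exists [::].
move=> v w av vw wb wvd [ts pt lt]; exists (rcons ts w); last by rewrite last_rcons.
rewrite rcons_path pt lt /strong_step vw /=; apply/asboolP => t vt tw.
have inab s : v <= s -> s <= w -> `[a, b]%classic s.
  by move=> vs sw; rewrite /= in_itv /= (le_trans av vs) (le_trans sw wb).
have bd s s' : v <= s -> s <= w -> v <= s' -> s' <= w -> ball s d s'.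
  by move=> h1 h2 h3 h4; rewrite /ball /= ltr_norml; apply/andP; split; lra.
have vw' := ltW vw.
by split; apply: gd; (apply: inab || apply: bd) => //; lra.
Qed.

Lemma strong_path_glue (m a : R) (g1 g2 : R -> X) (ts : seq R) :
  (forall v, m <= v -> g1 v = g2 v) -> m <= a ->
  path (strong_step g2) a ts -> path (strong_step g1) a ts /\ map g1 ts = map g2 ts.
Proof.
move=> e; elim: ts a => //= t ts ih a ma.
move=> /andP[/andP[at_ /asboolP h] pt]; have mt := le_trans ma (ltW at_).
have [-> ->] := ih t mt pt; rewrite e//; split=> //; rewrite andbT.
apply/andP; split=> //; apply/asboolP => v av vt.
by rewrite !e//; [exact: h|exact: le_trans av].
Qed.

Hypothesis Xgeo : geodesic_space X.

(** On a geodesic, the distances of a point to the two ends add up to at most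
    the distance of the ends. *)
Lemma geodesic_strong_step (x y : X) (a b : R) : a < b -> mdist x y < eps ->
  exists g : R -> X, [/\ {within `[a, b], continuous g}, g a = x, g b = y &
    strong_step g a b].
Proof.
move=> ab xy; have [a' [b' [g [ab' cg ga gb gl]]]] := Xgeo x y.
pose phi (t : R) := a' + (b' - a') * ((t - a) / (b - a)).
have ba : 0 < b - a by rewrite subr_gt0.
have phiab t : a <= t -> t <= b -> phi t \in `[a', b'].
  move=> at_ tb; rewrite in_itv /= /phi.
  have h0 : 0 <= (t - a) / (b - a) by rewrite divr_ge0 ?subr_ge0// ltW.
  have h1 : (t - a) / (b - a) <= 1 by rewrite ler_pdivrMr// mul1r lerD2r.
  have h2 : 0 <= b' - a' by rewrite subr_ge0.
  by apply/andP; split; nra.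
have phia : phi a = a' by rewrite /phi subrr mul0r mulr0 addr0.
have phib : phi b = b' by rewrite /phi divff ?gt_eqF// mulr1 addrC subrK.
exists (g \o phi); split; [|by rewrite /= phia|by rewrite /= phib|].
  apply: (@within_continuous_comp_image _ _ _ _ `[a', b']%classic phi g _ _ cg); last first.
    by move=> _ [t /= tab <-]; apply: phiab; move: tab; rewrite in_itv /= => /andP[].
  move=> t; apply: cvgD; first exact: cvg_cst.
  apply: cvgM; first exact: cvg_cst.
  apply: cvgM; last exact: cvg_cst.
  by apply: cvgD; [exact: cvg_id|exact: cvg_cst].
apply/andP; split=> //; apply/asboolP => t at_ tb; rewrite /= phia phib.
have := geodesic_between (a := a') (b := b') (g := g) _ (phiab t at_ tb).
rewrite ga gb gl => /(_ erefl) h; rewrite [mdist y _]metric_sym.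
have := mdist_ge0 x (g (phi t)); have := mdist_ge0 (g (phi t)) y.
by split; lra.
Qed.

(** Concatenate geodesics between consecutive points: a chain of at least two
    points is a strong chain along the path obtained. *)
Lemma chain_strong_path (x : X) (s : seq X) (a b : R) : a < b -> s <> [::] ->
  path (eps_step eps) x s ->
  exists (g : R -> X) (ts : seq R), [/\ {within `[a, b], continuous g}, g a = x,
    path (strong_step g) a ts, last a ts = b & map g ts = s].
Proof.
elim: s x a => // y s ih x a ab _ /= /andP[xy ys].
have [->|/eqP s0] := eqVneq s [::].
  have [g [cg ga gb st]] := geodesic_strong_step ab xy.
  by exists g, [:: b]; split=> //=; rewrite ?st ?gb.
pose m := (a + b) / 2; have am : a < m by rewrite /m; lra.
have mb : m < b by rewrite /m; lra.
have [g1 [cg1 g1a g1m st]] := geodesic_strong_step am xy.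
have [g2 [ts [cg2 g2m pt lt mt]]] := ih y m mb s0 ys.
pose g v := if v <= m then g1 v else g2 v.
have gg2 v : m <= v -> g v = g2 v.
  rewrite /g le_eqVlt => /orP[/eqP <-|mv]; last by rewrite leNgt mv.
  by rewrite lexx g1m g2m.
have gg1 v : v <= m -> g v = g1 v by rewrite /g => ->.
have [pt' mt'] := strong_path_glue gg2 (lexx m) pt.
exists g, (m :: ts); split=> //=.
- have -> : `[a, b]%classic = `[a, m]%classic `|` `[m, b]%classic.
    apply/seteqP; split=> v /=; rewrite !in_itv /=.
      by move=> /andP[-> ->]; have [_|/ltW ->] := leP v m; [left|right].
    case=> /andP[h1 h2]; first by rewrite h1 (le_trans h2 (ltW mb)).
    by rewrite h2 (le_trans (ltW am) h1).
  apply: withinU_continuous; [exact: itv_closed|exact: itv_closed| |].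
  + apply: (@subspace_eq_continuous _ _ _ g1 g _ cg1) =>
      v /set_mem /=; rewrite in_itv /= => /andP[_ h].
    exact/esym/gg1.
  + apply: (@subspace_eq_continuous _ _ _ g2 g _ cg2) =>
      v /set_mem /=; rewrite in_itv /= => /andP[h _].
    exact/esym/gg2.
- by rewrite gg1// ltW.
- rewrite pt' andbT; move: st; rewrite /strong_step am /= => /asboolP st.
  by apply/asboolP => v av vm; rewrite !gg1// ?(ltW am)//; exact: st.
- by rewrite gg1// g1m mt' mt.
Qed.

End StrongSteps.

(** * Homotopy invariance of strong chains *)
Section RadialLift.
Context {R : realType} {X : metricType R}.
Variables (eps : R) (Z : Type) (p : Z -> X) (act : Z -> X -> Z).
Hypothesis A : local_action eps p act.
Hypothesis eps0 : 0 < eps.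
Notation square := (`[0, 1]%classic `*` `[0, 1]%classic : set (R * R)).
Variables (H : R * R -> X) (e0 : Z).
Hypothesis Hc : {within square, continuous H}.
Hypothesis He0 : p e0 = H (0, 0).

Definition ray_point (N k : nat) (u : R * R) : R * R :=
  (k%:R / N%:R * u.1, k%:R / N%:R * u.2).

Fixpoint radial_lift (N k : nat) (u : R * R) : Z :=
  if k is k'.+1 then act (radial_lift N k' u) (H (ray_point N k u)) else e0.

Lemma squareP (u : R * R) : square u <-> [/\ 0 <= u.1, u.1 <= 1, 0 <= u.2 & u.2 <= 1].
Proof.
rewrite /= /setX /= !in_itv /=; split=> [[/andP[-> ->] /andP[-> ->]]//|[-> -> -> ->]//].
Qed.

(** E u is obtained by acting on e0 with a fine chain along the image of the
    segment from (0, 0) to u.  For close u and v the two chains stay close step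
    by step, and acting successively on the small triangles between them gives
    the coherence E v = act (E u) (H v): E is a continuous lift of H. *)
Lemma lift_square : exists (E : R * R -> Z) (d : R), [/\ 0 < d,
  forall u, square u -> p (E u) = H u,
  forall u v, square u -> square v -> ball u d v ->
    mdist (H u) (H v) < eps /\ E v = act (E u) (H v) &
  (forall t, 0 <= t -> t <= 1 -> H (0, t) = H (0, 0)) ->
    forall t, 0 <= t -> t <= 1 -> E (0, t) = e0].
Proof.
have sqc : compact square.
  by apply: compact_setX; exact: segment_compact.
have [d d0 Hd] := compact_uniformly_continuous sqc Hc eps0.
(* Steps shorter than d / 2, leaving d / 2 for the distance of u and v. *)
pose N := (Num.bound (2 / d)).+1.
have N0 : 0 < N%:R :> R by rewrite ltr0n.
have Nd : N%:R^-1 < d / 2.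
  rewrite -[d / 2]invrK ltf_pV2 ?posrE ?invr_gt0 ?divr_gt0// invf_div.
  have h := @archi_boundP R (2 / d) (ltW (divr_gt0 (ltr0Sn _ 1) d0)).
  by rewrite (lt_trans h)// ltr_nat.
have sk (k : nat) : (k <= N)%N -> 0 <= k%:R / N%:R :> R /\ k%:R / N%:R <= 1 :> R.
  by move=> kN; rewrite divr_ge0// ler_pdivrMr// mul1r ler_nat.
have sq k u : (k <= N)%N -> square u -> square (ray_point N k u).
  move=> /sk[k0 k1] /squareP[a0 a1 b0 b1]; apply/squareP => /=.
  by rewrite !mulr_ge0//; split=> //; rewrite mulr_ile1.
have ballP2 (u v : R * R) r : `|u.1 - v.1| < r -> `|u.2 - v.2| < r -> ball u r v.
  by move=> h1 h2; split.
have close k u v : (k <= N)%N -> square u -> square v -> ball u (d / 2) v ->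
    mdist (H (ray_point N k u)) (H (ray_point N k v)) < eps.
  move=> kN su sv [/= uv1 uv2]; have [k0 k1] := sk k kN.
  apply: Hd; [exact: sq|exact: sq|].
  rewrite /ball /= in uv1 uv2.
  by apply: ballP2; rewrite /= -mulrBr normrM ger0_norm//;
    apply: le_lt_trans (ler_piMl _ k1) _ => //; lra.
have diag k u v : (k.+1 <= N)%N -> square u -> square v -> ball u (d / 2) v ->
    mdist (H (ray_point N k u)) (H (ray_point N k.+1 v)) < eps.
  move=> kN su sv [/= uv1 uv2]; have [k0 k1] := sk k (ltnW kN).
  apply: Hd; [by apply: sq => //; exact: ltnW|exact: sq|].
  have /squareP[a0 a1 b0 b1] := sv.
  have key (x y : R) : ball x (d / 2) y -> 0 <= y -> y <= 1 ->
      `|k%:R / N%:R * x - k.+1%:R / N%:R * y| < d.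
    rewrite /ball /= => xy y0 y1.
    rewrite -natr1 2!mulrDl mul1r opprD addrA -mulrBr.
    apply: le_lt_trans (ler_normB _ _) _.
    have Ny : 0 <= N%:R^-1 * y by rewrite mulr_ge0 ?invr_ge0.
    rewrite (ger0_norm Ny) normrM (ger0_norm k0).
    have h1 : k%:R / N%:R * `|x - y| <= `|x - y| by rewrite ler_piMl.
    have h2 : N%:R^-1 * y <= N%:R^-1 by rewrite ler_piMr// invr_ge0.
    lra.
  by apply: ballP2; exact: key.
have selfb u r : 0 < r -> ball u r u by move=> r0; exact: ballxx.
have d20 : 0 < d / 2 by rewrite divr_gt0.
have sh0 u : ray_point N 0 u = (0, 0) by rewrite /ray_point !mul0r.
have shN u : ray_point N N u = u.
  by case: u => a b; rewrite /ray_point divff ?gt_eqF// !mul1r.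
have tipk k u : (k <= N)%N -> square u -> p (radial_lift N k u) = H (ray_point N k u).
  elim: k => [|k ih] kN su; first by rewrite sh0.
  rewrite /= (act_tip A)// ih ?(ltnW kN)//.
  by apply: diag => //; exact: selfb.
(* The quadrilateral between the steps k and k + 1 of the two chains is cut
   along its diagonal from step k on the side of u to step k + 1 on that of v. *)
have coh k u v : (k <= N)%N -> square u -> square v -> ball u (d / 2) v ->
    radial_lift N k v = act (radial_lift N k u) (H (ray_point N k v)).
  elim: k => [|k ih] kN su sv uv; first by rewrite sh0 -He0 (act_id A).
  have kN' := ltnW kN.
  rewrite [LHS]/= ih// (act_tri A) ?tipk//; last 3 first.
  - exact: close.
  - by apply: diag => //; exact: selfb.
  - exact: diag.
  rewrite [in RHS]/= (act_tri A) ?tipk//.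
  - by apply: diag => //; exact: selfb.
  - exact: close.
  - exact: diag.
exists (radial_lift N N), (d / 2); split=> //.
- by move=> u su; rewrite tipk// shN.
- move=> u v su sv uv; rewrite (coh N u v)// shN; split=> //.
  by have := close N u v (leqnn N) su sv uv; rewrite !shN.
- move=> Hx t t0 t1; suff : forall k, (k <= N)%N -> radial_lift N k (0, t) = e0 by exact.
  elim=> [//|k ih] kN; rewrite [LHS]/= ih ?(ltnW kN)//.
  have [k0 k1] := sk _ kN.
  have -> : H (ray_point N k.+1 (0, t)) = p e0.
    by rewrite /ray_point /= mulr0 He0; apply: Hx; rewrite ?mulr_ge0// mulr_ile1.
  exact: (act_id A).
Qed.

End RadialLift.

Section HomotopyInvariance.
Context {R : realType} {X : metricType R}.
Variables (eps : R) (Z : Type) (p : Z -> X) (act : Z -> X -> Z).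
Hypothesis A : local_action eps p act.

(** A strong chain transports along a lift E of its path: over a strong step
    from a to u, the relation E v = act (E a) (g v) propagates from v = a to
    v = u, all the points g v being within eps of g a. *)
Lemma strong_chain_act (E : R -> Z) (g : R -> X) (d a b : R) (ts : seq R) :
  0 < d -> (forall t, a <= t -> t <= b -> p (E t) = g t) ->
  (forall t u, a <= t -> t < u -> u <= b -> u - t < d ->
    mdist (g t) (g u) < eps /\ E u = act (E t) (g u)) ->
  path (strong_step eps g) a ts -> last a ts = b ->
  foldl act (E a) (map g ts) = E b.
Proof.
move=> d0; elim: ts a => [a _ _ _ <- //|u ts ih a pE coh /= /andP[st pt] lt].
have ub : u <= b.
  apply: (@itv_partition_le _ _ u b ts); split; last exact/eqP.
  by apply: sub_path pt => x y /andP[].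
have /andP[au /asboolP stb] := st.
suff -> : act (E a) (g u) = E u.
  apply: ih => // [t ut tb|t v ut tv vb]; [apply: pE|apply: coh] => //;
    exact: le_trans (ltW au) ut.
apply/esym; have aa : p (E a) = g a by apply: pE => //; exact: le_trans (ltW au) ub.
apply: (@segment_ind _ d a u (fun v => E v = act (E a) (g v)) d0 (ltW au)).
  by rewrite -aa (act_id A).
move=> v w av vw wu wvd Ev; have wb := le_trans wu ub.
have [gvw ->] := coh v w av vw wb wvd.
have [av' _] := stb v av (le_trans (ltW vw) wu).
have [aw' _] := stb w (le_trans av (ltW vw)) wu.
by rewrite Ev (act_tri A) ?aa.
Qed.

(** Lift the homotopy.  The lift is constant on the two vertical sides of the
    square, where the homotopy is constant; a strong chain along a horizontal
    side acts as transport along that side. *)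
Lemma homotopic_strong_chains_act (x0 : X) (e0 : Z) (g g' : R -> X) (c c' : seq X) :
  0 < eps -> p e0 = x0 -> loop x0 g -> loop x0 g' -> loop_homotopic x0 g g' ->
  strong_eps_chain eps 0 1 g c -> strong_eps_chain eps 0 1 g' c' ->
  foldl act e0 (behead c) = foldl act e0 (behead c').
Proof.
move=> eps0 pe0 [_ g0 _] [_ g'0 _] [H [Hc Hg Hg' Hl Hr]].
have in01 t : 0 <= t -> t <= 1 -> t \in `[0 : R, 1].
  by move=> t0 t1; rewrite in_itv /= t0.
have zero01 : 0 \in `[0 : R, 1] by rewrite in01.
have one01 : 1 \in `[0 : R, 1] by rewrite in01.
have pH : p e0 = H (0, 0) by rewrite Hl.
have [E [d [d0 pE coh E0]]] := lift_square A eps0 Hc pH.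
have {}E0 t : 0 <= t -> t <= 1 -> E (0, t) = e0.
  by apply: E0 => u u0 u1; rewrite !Hl// in01.
have row (h : R -> X) t k : 0 <= t -> t <= 1 ->
    (forall s : R, s \in `[0, 1] -> H (s, t) = h s) ->
    strong_eps_chain eps 0 1 h k -> foldl act e0 (behead k) = E (1, t).
  move=> t0 t1 Hh /strong_eps_chainP[ts [pt lt ->]] /=.
  rewrite -(E0 t)//; apply: (strong_chain_act d0 _ _ pt lt (E := fun s => E (s, t))).
    by move=> s s0 s1; rewrite pE ?Hh ?in01//; apply/squareP.
  move=> s u s0 su u1 us; rewrite -!Hh ?in01 ?(le_trans s0 (ltW su)) ?(le_trans (ltW su) u1)//.
  apply: coh; [by apply/squareP; rewrite /= s0 (le_trans (ltW su) u1)|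
               by apply/squareP; rewrite /= u1 (le_trans s0 (ltW su))|].
  split; last exact: ballxx.
  by rewrite /ball /= distrC gtr0_norm// subr_gt0.
move=> sc sc'; rewrite (row g 0 c (lexx _) ler01 Hg sc).
rewrite (row g' 1 c' ler01 (lexx _) Hg' sc'); apply/esym.
apply: (@segment_ind _ d 0 1 (fun t => E (1, t) = E (1, 0)) d0) => // v w v0 vw w1 wv <-.
have v1 := le_trans (ltW vw) w1; have w0 := le_trans v0 (ltW vw).
have sv : (`[0, 1]%classic `*` `[0, 1]%classic) ((1 : R), v) by apply/squareP.
have sw : (`[0, 1]%classic `*` `[0, 1]%classic) ((1 : R), w) by apply/squareP.
have [|_ ->] := coh _ _ sv sw.
  split; first exact: ballxx.
  by rewrite /ball /= distrC gtr0_norm// subr_gt0.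
by rewrite Hr ?in01// -[RHS](act_id A) pE// Hr// in01.
Qed.

End HomotopyInvariance.

(** * The fundamental group *)
Section FundamentalGroup.
Context {R : realType} {X : metricType R}.
Variable x0 : X.

(** The class of a chain is the result of its action on the class of the
    constant chain. *)
Lemma homotopic_strong_chains (eps : R) (g g' : R -> X) (c c' : seq X) :
  0 < eps -> loop x0 g -> loop x0 g' -> loop_homotopic x0 g g' ->
  strong_eps_chain eps 0 1 g c -> strong_eps_chain eps 0 1 g' c' ->
  eps_homotopic eps c c'.
Proof.
move=> eps0 lg lg' gg' sc sc'.
have based k : eps_loop x0 eps k -> based_chain x0 eps k.
  by case=> -[_ sk] ek; rewrite /based_chain sk andbT; case: k ek {sk} => //= x s [-> _].
have bc := based _ (strong_chain_loop lg sc).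
have bc' := based _ (strong_chain_loop lg' sc').
apply/(chain_class_eq bc bc'); rewrite (chain_class_foldl bc) (chain_class_foldl bc').
apply: (homotopic_strong_chains_act (extend_action x0 eps0)) gg' sc sc' => //.
by rewrite tip_chain_class ?based_chain0.
Qed.

Lemma loop_homotopic_refl (g : R -> X) : loop x0 g -> loop_homotopic x0 g g.
Proof.
case=> cg g0 g1; exists (g \o fst); split=> //.
have cfst : continuous (@fst R R) by move=> u; exact: cvg_fst.
have sub : fst @` (`[0, 1] `*` `[0, 1] : set (R * R)) `<=` `[0, 1].
  by move=> _ [u [u1 _] <-].
exact: (within_continuous_comp_image cfst sub cg).
Qed.

Lemma pi_cl_full_null : geodesic_space X ->
  pi_cl x0 = pi1 x0 <-> loops_null x0.
Proof.
move=> Xgeo.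
have h_epsP (eps : R) g : 0 < eps -> loop x0 g -> exists g' c',
    [/\ loop x0 g', loop_homotopic x0 g g', strong_eps_chain eps 0 1 g' c' &
        h_eps x0 eps (loop_class x0 g) = eps_class x0 eps c'].
  move=> eps0 lg; have [cg _ _] := lg.
  have [c sc] := strong_chain_exists eps0 ler01 cg.
  have /getPex[g' [c' [[lg' gg'] sc' e]]] : exists e, exists g' c',
      [/\ loop_class x0 g g', strong_eps_chain eps 0 1 g' c' & e = eps_class x0 eps c'].
    exists (eps_class x0 eps c), g, c; split=> //.
    by split=> //; exact: loop_homotopic_refl.
  by exists g', c'; split.
split=> [full eps c eps0 lc|N].
  have [[_ sc] ec] := lc.
  case: c lc ec sc => // x s lc [ex ls]; rewrite {}ex in lc ls * => sc.
  have [->|/eqP s0] := eqVneq s [::]; first exact: rt_refl.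
  have [g [ts [cg g0 pt lt ms]]] := chain_strong_path Xgeo ltr01 s0 sc.
  have lg : loop x0 g by split=> //; rewrite -lt -(last_map g) ms g0.
  have scg : strong_eps_chain eps 0 1 g (x0 :: s).
    by apply/strong_eps_chainP; exists ts; rewrite /= g0 ms.
  have : pi_cl x0 (loop_class x0 g) by rewrite full; exists g.
  move=> /(_ eps eps0) [_ /= hg].
  have [g' [c' [lg' gg' sc' e]]] := h_epsP _ _ eps0 lg.
  have h : eps_class x0 eps c' = eps_class x0 eps [:: x0] by rewrite -e.
  have lc' := strong_chain_loop lg' sc'.
  apply: rt_trans (homotopic_strong_chains eps0 lg lg' gg' scg sc') _.
  by apply/(eps_class_eq lc' (trivial_loop _ _)).
apply/seteqP; split=> [q /(_ 1 ltr01) []//|_ [g lg <-] eps /= eps0].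
split; first by exists g.
have [g' [c' [lg' gg' sc' e]]] := h_epsP _ _ eps0 lg.
rewrite /= e; have lc' := strong_chain_loop lg' sc'.
by apply/(eps_class_eq lc' (trivial_loop _ _)); exact: N.
Qed.

End FundamentalGroup.

Theorem corollary4p9 (R : realType) (X : metricType R) (x0 : X)
    (Xgeo : geodesic_space X) (Xcpt : compact [set: X]) :
  (universal_cover (@idfun X) <-> pi_cl x0 = pi1 x0) /\
  (pi_cl x0 = pi1 x0 <-> Cr x0 = set0).
Proof.
have piN := pi_cl_full_null x0 Xgeo; have CrN := Cr_empty_null x0.
split; last by rewrite piN CrN.
rewrite piN; split; first exact: universal_cover_null.
exact: null_universal_cover.
Qed.
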